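(* Let $q$ be a fixed prime power and $k\ge 2$ a fixed integer. Let $m_1,\dots,m_k$ be positive integers with $m_1=\max_{1\le i\le k-1}m_i$. Assume that $m_1\ge 3$ when $k=2$ and that $m_1\ge 2$ when $k=3$. Then $$I_k(m_1,\dots,m_k)=N_k(m_1,\dots,m_k)-q\,N_k(m_1,\dots,m_{k-1},m_k-1)+O\bigl(q^{m_1(m_2+1)\cdots(m_k+1)}\bigr).$$
   Context: $\mathbb F_q$ is the finite field with $q$ elements. Two polynomials in $\mathbb F_q[x_1,\dots,x_k]$ are identified if they differ by a factor in $\mathbb F_q^\times$; the classes are called normalized polynomials. The vector degree of a nonzero $f$ is $\operatorname{Deg} f=(\deg_{x_1}f,\dots,\deg_{x_k}f)$. For a $k$-tuple $\mathfrak m$ of nonnegative integers, $N_k(\mathfrak m)$ is the number of normalized polynomials $f\in\mathbb F_q[x_1,\dots,x_k]$ with $\operatorname{Deg} f=\mathfrak m$, and $I_k(\mathfrak m)$ is the number of those that are irreducible. The notation $O(A(m_1,\dots,m_k))$ denotes a function $B(m_1,\dots,m_k)$ with $|B|\le C\,A$ for all $m_1,\dots,m_k$ in the described range, where $C>0$ is a constant independent of $m_1,\dots,m_k$ (it may depend on $q$ and $k$). *)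

(* Defs.v *)
From mathcomp Require Import all_boot all_order all_algebra finmap.
From mathcomp Require Import mpoly.
From mathcomp Require Import boolp classical_sets functions cardinality reals.

Set Implicit Arguments.
Unset Strict Implicit.
Unset Printing Implicit Defensive.

Import Order.TTheory GRing.Theory Num.Theory.
Local Open Scope classical_set_scope.
Local Open Scope fset_scope.
Local Open Scope ring_scope.

Section NormalizedPolynomials.
Variables (F : finFieldType) (k : nat).
Implicit Types (f g h : {mpoly F[k]}) (m : 'X_{1..k}).

(* The k-tuple (deg_{x_1} f, ..., deg_{x_k} f); it is only meaningful for
   f != 0 (it is the zero tuple when f = 0). *)
Definition vdeg f : 'X_{1..k} :=
  [multinom (\max_(a <- msupp f) a i)%N | i < k].

Definition irreducible_mpoly f : Prop :=
  [/\ f != 0, f \isn't a GRing.unit &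
      forall g h, f = g * h -> g \is a GRing.unit \/ h \is a GRing.unit].

Definition normalized f : set {mpoly F[k]} :=
  [set c *: f | c in [set c : F | c != 0]].

Definition vdeg_set m : set {mpoly F[k]} := [set f | f != 0 /\ vdeg f = m].

(* [fset_set] is the empty set on infinite sets; both sets of classes counted
   below are finite, see [finite_normalized]. *)
Definition num_normalized m : nat :=
  #|` fset_set (normalized @` vdeg_set m)|.

Definition num_irreducible m : nat :=
  #|` fset_set (normalized @` (vdeg_set m `&` irreducible_mpoly))|.

Lemma finite_vdeg_set m : finite_set (vdeg_set m).
Proof.
pose b := (mdeg m).+1.
pose G (c : {ffun 'X_{1..k < b} -> F}) : {mpoly F[k]} :=
  \sum_(a : 'X_{1..k < b}) c a *: 'X_[a].
apply: (@sub_finite_set _ _ (G @` setT)); last first.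
  by apply: finite_image; apply: finite_finset.
move=> f [_ fm]; exists [ffun a : 'X_{1..k < b} => f@_a] => //.
have fb : (msize f <= b)%N.
  rewrite msizeE; apply/bigmax_leqP_seq => a af _.
  rewrite /b ltnS !mdegE; apply: leq_sum => i _.
  by rewrite -fm mnmE; apply: (leq_bigmax_seq (F := fun a : 'X_{1..k} => a i)).
rewrite [RHS](mpolywE fb); apply: eq_bigr => a _.
by rewrite ffunE.
Qed.

Lemma finite_normalized m (P : set {mpoly F[k]}) :
  finite_set (normalized @` (vdeg_set m `&` P)).
Proof.
apply: finite_image; apply: sub_finite_set (finite_vdeg_set m).
exact: subIsetl.
Qed.

End NormalizedPolynomials.

(* Main.v *)
(* Call [f] primitive if it has no nonconstant factor in [F[x_k]]. Every monic
   content of degree at least 1 is uniquely [x_k g + c], so the normalized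
   non-primitive polynomials of degree [m] number exactly [q N(m - e_k)], and
   [N(m) - q N(m - e_k)] counts the primitive ones. An irreducible polynomial of
   degree [m] is primitive, and a primitive reducible one is a product of two
   factors of degrees [a + b = m], each involving one of the first [k - 1]
   variables. There are at most [q ^ (M(a) + M(b))] such products, where
   [M(a) = \prod_i (a_i + 1)], and [M(a) + M(b) <= M(m - e_1) + 4 - |a|] when
   [|a| <= |b|]; summing a geometric series over [a] gives the error term. *)

Require Import Defs.
From mathcomp Require Import all_boot all_order all_algebra finmap.
From mathcomp Require Import mpoly.
From mathcomp Require Import boolp classical_sets functions cardinality reals.
From mathcomp Require Import zify lra.
Import Order.TTheory GRing.Theory Num.Theory.
Local Open Scope ring_scope.

Set Implicit Arguments.
Unset Strict Implicit.
Unset Printing Implicit Defensive.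

(** * Inequalities for products of successors, the sizes of boxes of exponents *)

Section BoxArithmetic.
Local Open Scope nat_scope.
Variables (I : finType) (P : pred I).

Let box (Q : pred I) (a : I -> nat) := \prod_(i | Q i) (a i).+1.

Lemma prod_succ_gt0 (Q : pred I) (a : I -> nat) : 0 < box Q a.
Proof. by apply: prodn_cond_gt0. Qed.

Lemma prod_succ_superadd (Q : pred I) (a b : I -> nat) :
  box Q a + box Q b <= (box Q (fun i => a i + b i)).+1.
Proof.
suff : [/\ 0 < box Q a, 0 < box Q b &
  box Q a + box Q b <= (box Q (fun i => a i + b i)).+1] by case.
rewrite /box; apply: (big_rec3 (fun x y z => [/\ 0 < x, 0 < y & x + y <= z.+1])).
  by [].
move=> i x y z _ [x0 y0 xyz]; split; rewrite ?muln_gt0 //.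
(* Positivity of [x] and [y] is carried along because the step rests on [a i * x + b i * y <= (a i +
   b i) * (x + y - 1) <= (a i + b i) * z]. *)
by have := leq_mul (leqnn (a i + b i)) xyz; nia.
Qed.

Lemma leq_sum_succ (Q : pred I) (a : I -> nat) :
  (\sum_(i | Q i) a i).+1 <= box Q a.
Proof.
rewrite /box; apply: (big_ind2 (fun x y => x.+1 <= y)) => // x y x' y' h h'.
by nia.
Qed.

(** The right side is 2 plus the box of [a + b] lowered by one at [i]. An index in both supports
    serves as [i]: both factors there exceed 1, and superadditivity is applied to the remaining
    coordinates. If the supports are disjoint, any [i] in the support of [a] serves. *)
Lemma prod_succ_split (a b : I -> nat) :
  (exists2 i, P i & 0 < a i) -> (exists2 i, P i & 0 < b i) ->
  exists2 i, P i & box P a + box P b <=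
    (a i + b i) * box (fun j => P j && (j != i)) (fun j => a j + b j) + 2.
Proof.
move=> [i Pi ai] [j Pj bj].
have [[l Pl /andP[al bl]]|nl] :=
    pselect (exists2 l, P l & (0 < a l) && (0 < b l)).
  exists l => //; rewrite {1 2}/box (bigD1 l) //= [X in _ + X](bigD1 l) //=.
  have := prod_succ_superadd (fun j => P j && (j != l)) a b.
  have := prod_succ_gt0 (fun j => P j && (j != l)) a.
  have := prod_succ_gt0 (fun j => P j && (j != l)) b.
  rewrite /box; set B := \prod_(_ | _) _.+1; set A := \prod_(_ | _) _.+1.
  set S := \prod_(_ | _) _.+1 => B0 A0 ABS.
  case: (a l) al => // x _; case: (b l) bl => // y _.
  have : x * A <= x * S by rewrite leq_mul2l; apply/orP; right; lia.
  have : y * B <= y * S by rewrite leq_mul2l; apply/orP; right; lia.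
  by nia.
(* Disjoint supports: with [a i = x + 1], [b j = y + 1] and [A], [B], [S] taken away from [i] and
   [j], the claim becomes [(x + 2) A + (y + 2) B <= (x + 1) (y + 2) S + 2], to be deduced from
   [A + B <= S + 1]. *)
exists i => //.
have bi : b i = 0.
  by apply/eqP; rewrite eqn0Ngt; apply/negP => h; apply: nl; exists i; rewrite ?ai.
have aj : a j = 0.
  by apply/eqP; rewrite eqn0Ngt; apply/negP => h; apply: nl; exists j; rewrite ?h.
have ji : j != i by apply: contraTneq bj => ->; rewrite bi.
rewrite /box (bigD1 i) //= [X in _ + X](bigD1 i) //= bi mul1n addn0.
rewrite (bigD1 j) /=; last by rewrite Pj.
rewrite [X in _ + X](bigD1 j) /=; last by rewrite Pj.
rewrite [X in _ <= _ * X + _](bigD1 j) /=; last by rewrite Pj.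
rewrite aj mul1n add0n.
have := prod_succ_superadd (fun l => P l && (l != i) && (l != j)) a b.
have := prod_succ_gt0 (fun l => P l && (l != i) && (l != j)) a.
have := prod_succ_gt0 (fun l => P l && (l != i) && (l != j)) b.
rewrite /box; set B := \prod_(_ | _) _.+1; set A := \prod_(_ | _) _.+1.
set S := \prod_(_ | _) _.+1 => B0 A0 ABS.
case: (a i) ai => // x _; case: (b j) bj => // y _.
have h1 : y.+1 * B <= y.+1 * (S.+1 - A) by rewrite leq_mul2l; apply/orP; right; lia.
have [u eS] : exists u, S = A + u by exists (S - A); lia.
move: h1; rewrite eS (_ : (A + u).+1 - A = u.+1); last by lia.
case: A A0 eS {ABS} => // A _ _ h1.
by nia.
Qed.

(** Each side is the full box times [m i / (m i + 1)], which increases with [m i]. Hence lowering a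
    largest coordinate leaves the largest box. *)
Lemma leq_punctured_prod_succ (m : I -> nat) i j : P i -> P j -> m i <= m j ->
  m i * box (fun l => P l && (l != i)) m <= m j * box (fun l => P l && (l != j)) m.
Proof.
move=> Pi Pj mij; have [->//|ij] := eqVneq i j.
rewrite /box (bigD1 j) /=; last by rewrite Pj eq_sym.
rewrite [X in _ <= _ * X](bigD1 i) /=; last by rewrite Pi.
rewrite (eq_bigl (fun l => P l && (l != j) && (l != i))); last first.
  by move=> l /=; rewrite -!andbA [(l != i) && _]andbC.
by rewrite !mulnA leq_mul2r; apply/orP; right; nia.
Qed.

End BoxArithmetic.

(* [A], [B] count the exponents of the first variables and [s], [t] are the
   degrees in the last one, so that the two factors have [A * s.+1] and
   [B * t.+1] coefficients. The summand [A + s] makes the sum over all degree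
   splittings converge. *)
Lemma two_box_exponent (A B P s t : nat) :
  (1 < A -> A <= B -> A + B <= P + 2 -> B <= P -> 2 < P -> 0 < s + t ->
  A * s.+1 + B * t.+1 + (A + s) <= P * (s + t).+1 + 5)%N.
Proof.
move=> A1 AB ABP BP P3 st.
have [u eP] : exists u, (P = B + u)%N by exists (P - B)%N; lia.
have [v eB] : exists v, (B = A + v)%N by exists (B - A)%N; lia.
subst P B.
(* The hypothesis [A + B <= P + 2] now reads [A <= u + 2]. If [v = 0], then [u = 0] would give
   [P = A <= 2], against [2 < P]. *)
have [v0|v0] := posnP v.
  subst v; have u0 : (0 < u)%N by lia.
  have : (u + (s + t) <= u * (s + t) + 1)%N by nia.
  by nia.
have : (u <= u * (s + t))%N by nia.
have : (s <= v * s)%N by nia.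
nia.
Qed.

(** The only place where the extra assumptions for two and three variables enter. From four
    variables on, two factors [(m i).+1 >= 2] suffice. *)
Lemma punctured_prod_gt2 n (m : 'X_{1..n.+2}) : (forall i, 0 < m i)%N ->
  (n.+2 = 2 -> 3 <= m ord0)%N -> (n.+2 = 3 -> 2 <= m ord0)%N ->
  (2 < m ord0 * \prod_(i | (i != ord_max) && (i != ord0)) (m i).+1)%N.
Proof.
case: n m => [|[|n']] m m0 h3 h2.
- by rewrite big1 ?muln1 ?h3 // => -[[|[|i]]].
- rewrite (bigD1 (inord 1)) /=; last by rewrite -!val_eqE /= inordK.
  have := h2 erefl; have := m0 (inord 1); set z := \prod_(_ | _) _.
  have : (0 < z)%N by apply: prod_succ_gt0.
  by nia.
- rewrite (bigD1 (inord 1)) /=; last by rewrite -!val_eqE /= inordK.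
  rewrite (bigD1 (inord 2)) /=; last by rewrite -!val_eqE /= !inordK.
  set z := \prod_(_ | _) _; have z0 : (0 < z)%N by apply: prod_succ_gt0.
  have := m0 (inord 1); have := m0 (inord 2); have := m0 ord0.
  set x := m ord0; set y := m (inord 2); set w := m (inord 1) => x0 y0 w0.
  have : (1 * (2 * (2 * 1)) <= x * (w.+1 * (y.+1 * z)))%N by rewrite !leq_mul.
  exact: leq_trans.
Qed.

(** * The exponent for a product of two factors of prescribed degrees *)

Section Exponent.
Local Open Scope nat_scope.
Variables (n : nat) (m : 'X_{1..n.+2}).
Hypothesis m_gt0 : forall i, 0 < m i.
Hypothesis m_max : m ord0 = \max_(i < n.+2 | i != ord_max) m i.
Hypothesis m_ge3 : n.+2 = 2 -> 3 <= m ord0.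
Hypothesis m_ge2 : n.+2 = 3 -> 2 <= m ord0.

Let P (i : 'I_n.+2) := i != ord_max.
(** The box of [m - e_1] in all variables but the last; the exponent of the error term is
    [R * (m ord_max).+1]. *)
Let R := m ord0 * \prod_(i | P i && (i != ord0)) (m i).+1.

Let P0 : P ord0. Proof. by []. Qed.

Let R_gt2 : 2 < R.
Proof. exact: punctured_prod_gt2. Qed.

Let exponent_bound_le (a b : 'X_{1..n.+2}) : (a + b)%MM = m ->
  (exists2 i, P i & 0 < a i) -> (exists2 i, P i & 0 < b i) ->
  \prod_(i | P i) (a i).+1 <= \prod_(i | P i) (b i).+1 ->
  \prod_i (a i).+1 + \prod_i (b i).+1 + mdeg a
    <= m ord0 * \prod_(i | i != ord0) (m i).+1 + 4.
Proof.
move=> abm a0 b0; have abi i : a i + b i = m i by rewrite -abm mnmDE.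
have leR i : P i -> m i * \prod_(j | P j && (j != i)) (m j).+1 <= R.
  move=> Pi; apply: leq_punctured_prod_succ => //.
  by rewrite m_max; apply: leq_bigmax_cond.
rewrite mdegE ![\prod_i _](bigD1 ord_max) //=.
rewrite (bigD1 (P := [pred i | i != ord0]) ord_max) //=.
rewrite [\sum_i _](bigD1 ord_max) //= -[in (m ord_max).+1]abi.
have -> : \prod_(i | (i != ord0) && (i != ord_max)) (m i).+1 =
  \prod_(i | P i && (i != ord0)) (m i).+1 by apply: eq_bigl => i; rewrite andbC.
(* This gives [mdeg a + 1 <= A + a ord_max], which turns the constant 5 of [two_box_exponent] into
   4. *)
have := leq_sum_succ P a.
have [i Pi] := prod_succ_split a0 b0.
have -> : \prod_(j | P j && (j != i)) (a j + b j).+1 =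
  \prod_(j | P j && (j != i)) (m j).+1 by apply: eq_bigr => j _; rewrite abi.
rewrite abi => ABi; have {ABi} := leq_trans ABi (leq_add (leR i Pi) (leqnn 2)).
have A1 : 1 < \prod_(i | P i) (a i).+1.
  case: a0 => j Pj aj; rewrite (bigD1 j) //=.
  by rewrite -[2]/(2 * 1) leq_mul ?prod_succ_gt0.
(* Some [a j] is positive, so [(b j).+1 <= m j] and the box of [b] fits in the box of [m] lowered at
   [j]. *)
have BR : \prod_(i | P i) (b i).+1 <= R.
  case: a0 => j Pj aj; apply: leq_trans (leR j Pj).
  rewrite (bigD1 j) //=; apply: leq_mul; first by rewrite -abi; lia.
  by apply: leq_prod => l _; rewrite -abi; lia.
have st : 0 < a ord_max + b ord_max by rewrite abi.
move=> ABR sA AB; have := two_box_exponent A1 AB ABR BR R_gt2 st.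
rewrite [X in _ <= X + 4]mulnCA -/R ![(_ (ord_max)).+1 * _]mulnC.
move: sA; set A := \prod_(_ | _) _.+1; set B := \prod_(_ | _) _.+1.
rewrite [_.+1 * R]mulnC; set S := \sum_(_ | _) _.
lia.
Qed.

(** The gain obtained is the total degree of the factor with the smaller box over the first
    variables. That factor may be either one, and the minimum covers both cases. *)
Lemma exponent_bound (a b : 'X_{1..n.+2}) : (a + b)%MM = m ->
  (exists2 i, i != ord_max & 0 < a i) -> (exists2 i, i != ord_max & 0 < b i) ->
  \prod_i (a i).+1 + \prod_i (b i).+1 + minn (mdeg a) (mdeg b)
    <= m ord0 * \prod_(i | i != ord0) (m i).+1 + 4.
Proof.
move=> abm a0 b0.
have [AB|BA] := leqP (\prod_(i | P i) (a i).+1) (\prod_(i | P i) (b i).+1).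
  apply: leq_trans (exponent_bound_le abm a0 b0 AB).
  by rewrite leq_add2l geq_minl.
rewrite addmC in abm.
apply: leq_trans (exponent_bound_le abm b0 a0 (ltnW BA)).
by rewrite [X in X + _]addnC leq_add2l geq_minr.
Qed.

End Exponent.

(** * Additivity of the vector degree, and the embedding of [F[x_i]] *)

Lemma size_mulS (A : idomainType) (p q : {poly A}) x y :
  size p = x.+1 -> size q = y.+1 -> size (p * q) = (x + y).+1.
Proof.
move=> sp sq; rewrite size_mul -?size_poly_eq0 ?sp ?sq //.
by rewrite addSn addnS.
Qed.

Section VectorDegree.
Variables (F : finFieldType) (k : nat).
Implicit Types (f g : {mpoly F[k]}) (a b : 'X_{1..k}) (i : 'I_k).

Lemma vdeg_leP f i d :
  reflect (forall a, a \in msupp f -> (a i <= d)%N) (vdeg f i <= d)%N.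
Proof.
rewrite mnmE; apply: (iffP (bigmax_leqP_seq _ _ _ _)) => h a; last by move=> /h.
by move=> /h; apply.
Qed.

Lemma vdeg_attained f i : f != 0 ->
  exists2 a, a \in msupp f & a i = vdeg f i.
Proof.
rewrite -msupp_eq0 mnmE; elim: (msupp f) => // b s IH _.
have [->|s0] := eqVneq s [::].
  by exists b; rewrite ?mem_seq1 // big_seq1.
rewrite big_cons; have [a sa <-] := IH s0.
have [ba|ab] := leqP (b i) (a i); first by exists a; rewrite // inE sa orbT.
by exists b; rewrite // inE eqxx.
Qed.

(* [x_i] is replaced by [x_i * T] and the other variables are kept, so that the
   degree in [T] is the degree in [x_i]. *)
Definition mark_var i : {mpoly F[k]} -> {poly {mpoly F[k]}} :=
  mmap (polyC \o @mpolyC k F)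
       (fun j => if j == i then 'X * ('X_j)%:P else ('X_j)%:P).

Lemma coef_mark_var i f d a :
  ((mark_var i f)`_d)@_a = if a i == d then f@_a else 0.
Proof.
have mark1 b : mmap1 (fun j => if j == i then 'X * ('X_j)%:P else ('X_j)%:P) b
    = ('X_[b] : {mpoly F[k]})%:P * 'X^(b i).
  rewrite /mmap1 (bigD1 i) //= eqxx (eq_bigr (fun j => ('X_j ^+ b j)%:P)).
    rewrite -rmorph_prod exprMn -polyC_exp -mulrA -polyCM mulrC.
    by congr (_%:P * _); rewrite [RHS]mpolyXE_id [RHS](bigD1 i).
  by move=> j /negbTE ->; rewrite polyC_exp.
rewrite /mark_var /mmap coef_sum raddf_sum /=.
rewrite (eq_bigr (fun b => if b == a then (if b i == d then f@_b else 0) else 0)).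
  have [fa|nfa] := boolP (a \in msupp f).
    by rewrite (bigD1_seq a) //= eqxx big1 ?addr0 // => b /negbTE ->.
  rewrite big_seq big1 => [|b fb]; first by rewrite memN_msupp_eq0 // if_same.
  by rewrite ifN //; apply: contraNneq nfa => <-.
move=> b _; rewrite mark1 mulrA -polyCM mul_mpolyC coefCM coefXn eq_sym.
have [_|_] := eqVneq (b i) d; last by rewrite mulr0 mcoeff0 if_same.
by rewrite mulr1 mcoeffZ mcoeffX; case: eqP; rewrite ?mulr1 ?mulr0.
Qed.

Lemma size_mark_var i f : f != 0 -> size (mark_var i f) = (vdeg f i).+1.
Proof.
move=> f0; apply/eqP; rewrite eqn_leq; apply/andP; split.
  apply/leq_sizeP => d dlt; apply/mpolyP => a; rewrite mcoeff0 coef_mark_var.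
  have [ai|//] := eqVneq (a i) d; apply/memN_msupp_eq0/negP => fa.
  by have /vdeg_leP/(_ a fa) := leqnn (vdeg f i); rewrite ai leqNgt dlt.
have [a fa ai] := vdeg_attained i f0; rewrite ltnNge; apply/negP.
move=> /leq_sizeP/(_ _ (leqnn _))/(congr1 (mcoeff a)).
by rewrite coef_mark_var ai eqxx mcoeff0; apply/eqP; rewrite -mcoeff_msupp.
Qed.

Lemma mark_varM i f g : mark_var i (f * g) = mark_var i f * mark_var i g.
Proof. by rewrite /mark_var rmorphM. Qed.

(** For each variable, [mark_var] is multiplicative and reduces the claim to degrees of univariate
    polynomials over the integral domain [{mpoly F[k]}]. *)
Lemma vdegM f g : f != 0 -> g != 0 -> vdeg (f * g) = (vdeg f + vdeg g)%MM.
Proof.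
move=> f0 g0; apply/mnmP => i; apply: succn_inj; rewrite mnmDE.
rewrite -size_mark_var ?mulf_neq0 // mark_varM.
exact: (size_mulS (size_mark_var i f0) (size_mark_var i g0)).
Qed.

Lemma vdegZ c f : c != 0 -> vdeg (c *: f) = vdeg f.
Proof.
move=> c0; have eq_supp : msupp (c *: f) =i msupp f.
  by move=> a; rewrite !mcoeff_msupp mcoeffZ mulf_eq0 negb_or c0.
apply/mnmP => i; apply/eqP; rewrite eqn_leq; apply/andP; split.
  by apply/vdeg_leP => a; rewrite eq_supp; apply/vdeg_leP.
by apply/vdeg_leP => a; rewrite -eq_supp; apply/vdeg_leP.
Qed.

Lemma unit_mpolyC c : c != 0 -> (c%:MP : {mpoly F[k]}) \is a GRing.unit.
Proof.
move=> c0; apply/unitrP; exists (c^-1)%:MP.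
by rewrite -!mpolyCM mulVf // mulfV.
Qed.

Lemma unit_vdeg f : f \is a GRing.unit -> vdeg f = 0%MM.
Proof.
move=> /andP[/eqP -> _]; apply/mnmP => i; apply/eqP; rewrite mnm0E -leqn0.
apply/vdeg_leP => a; rewrite msuppC; case: ifP => // _.
by rewrite mem_seq1 => /eqP ->; rewrite mnm0E.
Qed.

Definition poly_in i : {poly F} -> {mpoly F[k]} := horner_alg 'X_i.

Lemma mcoeff_poly_in i p a :
  (poly_in i p)@_a = if a == (U_(i) *+ a i)%MM then p`_(a i) else 0.
Proof.
rewrite /poly_in /horner_alg /= /horner_morph horner_poly raddf_sum /=.
rewrite (eq_bigr (fun j : 'I__ => if (U_(i) *+ j)%MM == a then p`_j else 0)).
  have [ea|na] := eqVneq a _; last first.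
    apply: big1 => j _; case: eqP => // ej; case/eqP: na.
    by rewrite -ej mulmnE mnm1E eqxx mul1n.
  have [lt|ge] := ltnP (a i) (size p).
    rewrite (bigD1 (Ordinal lt)) //= -ea eqxx big1 ?addr0 // => j ja.
    case: eqP => // ej; case/eqP: ja; apply: val_inj => /=.
    by rewrite -ej mulmnE mnm1E eqxx mul1n.
  rewrite nth_default // big1 // => j _; case: eqP => // ej.
  have : (j < a i)%N by apply: leq_trans ge.
  by rewrite -ej mulmnE mnm1E eqxx mul1n ltnn.
move=> j _; rewrite mulr_algl mpolyXn mcoeffZ mcoeffX.
by case: eqP; rewrite ?mulr1 ?mulr0.
Qed.

End VectorDegree.

(** * Content and primitive part with respect to [F[x_i]] *)

Section Content.
Variables (F : finFieldType) (k : nat) (i : 'I_k).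
Implicit Types (f r : {mpoly F[k]}) (g h : {poly F}).
Local Notation iota := (@poly_in F k i).

Lemma poly_inM g h : iota (g * h) = iota g * iota h.
Proof. exact: rmorphM. Qed.

Lemma poly_inD g h : iota (g + h) = iota g + iota h.
Proof. exact: rmorphD. Qed.

Lemma poly_inC c : iota c%:P = c%:MP.
Proof. by rewrite /poly_in horner_algC -mul_mpolyC mulr1. Qed.

Lemma poly_in_neq0 g : g != 0 -> iota g != 0.
Proof.
move=> g0; apply: contraNneq g0 => /(congr1 (mcoeff (U_(i) *+ (size g).-1)%MM)).
rewrite mcoeff_poly_in mulmnE mnm1E eqxx mul1n eqxx mcoeff0 => /eqP.
by rewrite -[_`__]/(lead_coef g) lead_coef_eq0.
Qed.

Lemma vdeg_poly_in g : g != 0 -> vdeg (iota g) = (U_(i) *+ (size g).-1)%MM.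
Proof.
move=> g0; apply/mnmP => j; apply/eqP; rewrite eqn_leq; apply/andP; split.
  apply/vdeg_leP => a; rewrite mcoeff_msupp mcoeff_poly_in.
  case: (a =P _) => [ea ga|_]; last by rewrite eqxx.
  rewrite {1}ea !mulmnE leq_mul2l; apply/orP; right.
  rewrite -ltnS prednK ?size_poly_gt0 // ltnNge; apply: contra ga => ge.
  by rewrite nth_default.
have /vdeg_leP := leqnn (vdeg (iota g) j); apply.
rewrite mcoeff_msupp mcoeff_poly_in mulmnE mnm1E eqxx mul1n eqxx.
by rewrite -[_`__]/(lead_coef g) lead_coef_eq0.
Qed.

Lemma poly_in_surj f : (forall j, j != i -> vdeg f j = 0%N) ->
  exists g, f = iota g.
Proof.
move=> f0; exists (\poly_(d < (vdeg f i).+1) f@_(U_(i) *+ d)).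
apply/mpolyP => a; rewrite mcoeff_poly_in coef_poly ltnS.
have supp b : f@_b != 0 -> forall j, (b j <= vdeg f j)%N.
  by rewrite -mcoeff_msupp => fb j; have /vdeg_leP := leqnn (vdeg f j); apply.
have [fa|/supp sa] := eqVneq f@_a 0.
  rewrite fa; case: eqP => // ea; rewrite -ea fa; by case: ifP.
rewrite sa; case: eqP => [<- //|[]]; apply/mnmP => j.
rewrite mulmnE mnm1E; have [<-|ij] := eqVneq i j; first by rewrite mul1n.
by apply/eqP; rewrite mul0n -leqn0 -(f0 j) // eq_sym.
Qed.

(** [size h = 1] means a nonzero constant. Zero is not primitive, since every [iota h] divides
    it. *)
Definition primitive_in f := forall h r, f = iota h * r -> size h = 1%N.

Lemma primitive_in_neq0 f : primitive_in f -> f != 0.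
Proof.
move=> fP; apply/eqP => f0; suff : size ('X : {poly F}) = 1%N by rewrite size_polyX.
by apply: (fP _ 0); rewrite mulr0.
Qed.

Lemma primitive_inZ c f : c != 0 -> primitive_in f -> primitive_in (c *: f).
Proof.
move=> c0 fP h r cf; apply: (fP _ (c^-1 *: r)).
by rewrite -scalerAr -cf scalerA mulVf // scale1r.
Qed.

(** Induction on the degree in [x_i], which drops when a nonconstant factor from [F[x_i]] is divided
    out. Its leading coefficient is moved to the primitive part to keep the content monic. *)
Lemma content_exists f : f != 0 ->
  exists gp : {poly F} * {mpoly F[k]},
    [/\ gp.1 \is monic, primitive_in gp.2 & f = iota gp.1 * gp.2].
Proof.
have [d] := ubnP (vdeg f i); elim: d f => // d IH f fd f0.
have [fP|fnP] := pselect (primitive_in f).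
  exists (1, f); split; rewrite ?monic1 //=.
  by rewrite -[1]/(1%:P) poly_inC mul1r.
have [h [r [fhr h1]]] : exists h r, f = iota h * r /\ size h != 1%N.
  apply: contrapT => nex; apply: fnP => h r fhr; apply/eqP/negPn/negP => h1.
  by apply: nex; exists h, r.
have [h0 r0] : h != 0 /\ r != 0.
  move: f0; rewrite fhr mulf_eq0 negb_or => /andP[ih0 ->]; split=> //.
  by apply: contraNneq ih0 => ->; rewrite -[0]/(0%:P) poly_inC mpolyC0.
have rd : (vdeg r i < d)%N.
  move: fd; rewrite fhr vdegM ?poly_in_neq0 // mnmDE vdeg_poly_in //.
  rewrite mulmnE mnm1E eqxx mul1n ltnS.
  have : (0 < size h)%N by rewrite size_poly_gt0.
  by case: (size h) h1 => [|[|s]] //= _ _; apply: leq_trans; rewrite addSn ltnS leq_addl.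
have [[g p] [/= gM pP rgp]] := IH r rd r0.
have c0 : lead_coef h != 0 by rewrite lead_coef_eq0.
exists ((lead_coef h)^-1 *: (h * g), lead_coef h *: p); split => /=.
- by rewrite monicE lead_coefZ lead_coefM (monicP gM) mulr1 mulVf.
- exact: primitive_inZ.
- rewrite fhr rgp -mul_polyC !poly_inM poly_inC -mul_mpolyC.
  by rewrite mulrACA -mpolyCM mulVf // mpolyC1 mul1r mulrA.
Qed.

(** Bezout replaces unique factorization. After division by the gcd, [g' p = h' q] and
    [u g' + v h' = 1], whence [q = g' (u q + v p)] and [p = h' (u q + v p)]. Primitivity makes [g']
    and [h'] constant, so [g] and [h] are both associated to the gcd. *)
Lemma content_unique g h p q : g \is monic -> h \is monic ->
  primitive_in p -> primitive_in q -> iota g * p = iota h * q ->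
  g = h /\ p = q.
Proof.
move=> gM hM pP qP e; have g0 := monic_neq0 gM; have h0 := monic_neq0 hM.
suff gh : g = h.
  by split=> //; move: e; rewrite gh; apply: mulfI; apply: poly_in_neq0.
pose d := gcdp g h; have d0 : d != 0 by rewrite gcdp_eq0 negb_and g0.
have eg : g %/ d * d = g by rewrite divpK ?dvdp_gcdl.
have eh : h %/ d * d = h by rewrite divpK ?dvdp_gcdr.
have {}e : iota (g %/ d) * p = iota (h %/ d) * q.
  apply: (mulfI (poly_in_neq0 d0)).
  by rewrite !mulrA -!poly_inM ![d * _]mulrC eg eh.
have [[u v] /= uv] : exists u : {poly F} * {poly F},
    u.1 * (g %/ d) + u.2 * (h %/ d) = 1.
  by apply/Bezout_eq1_coprimepP/coprimep_div_gcd; rewrite g0.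
have bez r : r = iota u * (iota (g %/ d) * r) + iota v * (iota (h %/ d) * r).
  by rewrite !mulrA -mulrDl -!poly_inM -poly_inD uv -[1]/(1%:P) poly_inC mul1r.
have sg : size (g %/ d) = 1%N.
  apply: (qP _ (iota u * q + iota v * p)).
  by rewrite {1}[q]bez -e !mulrDr !(mulrCA _ (iota (g %/ d))).
have sh : size (h %/ d) = 1%N.
  apply: (pP _ (iota u * q + iota v * p)).
  by rewrite {1}[p]bez e !mulrDr !(mulrCA _ (iota (h %/ d))).
apply/eqP; rewrite -eqp_monic //.
have asc (w : {poly F}) : size (w %/ d) = 1%N -> w %/ d * d = w -> w %= d.
  move=> /eqP/size_poly1P[c c0 ->] <-.
  by rewrite mul_polyC eqp_scale.
by apply: eqp_trans (asc g sg eg) _; rewrite eqp_sym; apply: asc.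
Qed.

End Content.

(** * Cardinalities of finite sets: images, products, covers, complements *)

Section FiniteSetCardinality.
Local Open Scope classical_set_scope.

Lemma card_fset_set_image (T U : choiceType) (f : T -> U) (A : set T) :
  finite_set A -> (forall x y, A x -> A y -> f x = f y -> x = y) ->
  #|` fset_set (f @` A)| = #|` fset_set A|.
Proof.
move=> finA injf; rewrite fset_set_image // card_in_imfset //= => x y.
rewrite !in_fset_set // !inE; exact: injf.
Qed.

Lemma leq_card_fset_set_image (T U : choiceType) (f : T -> U) (A : set T) :
  finite_set A -> (#|` fset_set (f @` A)| <= #|` fset_set A|)%N.
Proof. by move=> finA; rewrite fset_set_image // leq_imfset_card. Qed.

Lemma card_fset_setX (T U : choiceType) (A : set T) (B : set U) :
  finite_set A -> finite_set B ->
  #|` fset_set (A `*` B)| = (#|` fset_set A| * #|` fset_set B|)%N.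
Proof.
move=> finA finB; rewrite fset_setX // -(size_allpairs (@pair T U)).
apply/perm_size/uniq_perm; rewrite ?fset_uniq //.
  by apply: allpairs_uniq => // -[x y] [x' y'] _ _ [-> ->].
move=> [x y]; rewrite in_fsetM /=; apply/andP/allpairsP.
  by move=> [xA yB]; exists (x, y).
by move=> [[x' y'] /= [xA yB [-> ->]]].
Qed.

Lemma leq_card_fset_set_cover (T : choiceType) (J : finType) (P : pred J)
    (S : set T) (B : J -> set T) :
  finite_set S -> (forall j, finite_set (B j)) ->
  (forall x, S x -> exists2 j, P j & B j x) ->
  (#|` fset_set S| <= \sum_(j | P j) #|` fset_set (B j)|)%N.
Proof.
move=> finS finB cover.
apply: (@leq_trans #|` (\bigcup_(j | P j) fset_set (B j))%fset|).
  apply/fsubset_leq_card/fsubsetP => x; rewrite in_fset_set // inE => /cover.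
  by move=> [j Pj Bx]; apply/bigfcupP; exists j;
    rewrite ?mem_index_enum ?Pj // in_fset_set // inE.
elim/big_rec2: _ => [|j s U _ IH]; first by rewrite cardfs0.
apply: leq_trans (leq_card_fsetU _ _) _; by rewrite leq_add2l.
Qed.

Lemma card_fset_setID (T : choiceType) (B A : set T) : finite_set A ->
  (#|` fset_set (A `&` B)| + #|` fset_set (A `\` B)| = #|` fset_set A|)%N.
Proof.
move=> finA; have finAB : finite_set (A `&` B).
  by apply: sub_finite_set finA; apply: subIsetl.
rewrite -(cardfsID (fset_set (A `&` B)) (fset_set A)).
by rewrite -fset_setI // -fset_setD // setIA setIid setDIr setDv set0U.
Qed.

Lemma card_nonzero (F : finFieldType) :
  #|` fset_set [set c : F | c != 0]| = #|F|.-1.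
Proof.
rewrite -(cardC1 (0 : F)) -card_finset; congr #|` _|.
apply/fsetP => c; rewrite in_fset_set; last exact: finite_finset.
by apply/idP/idP; rewrite !inE.
Qed.

Lemma leq_card_fset (T : finType) (A : {fset T}) : (#|` A| <= #|T|)%N.
Proof.
rewrite -(card_finset (T := T) predT) fsubset_leq_card //.
by apply/fsubsetP => x _; rewrite !inE.
Qed.

End FiniteSetCardinality.

(** * Passage from classes to polynomials, and the count of non-primitive polynomials *)

Section Counting.
Local Open Scope classical_set_scope.
Variables (F : finFieldType) (k : nat).
Implicit Types (f : {mpoly F[k]}) (m a : 'X_{1..k}) (i : 'I_k).

Lemma finite_vdeg_setI m (P : set {mpoly F[k]}) :
  finite_set (@vdeg_set F k m `&` P).
Proof.
apply: sub_finite_set (finite_vdeg_set F m); exact: subIsetl.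
Qed.

(** Each class has exactly one representative with leading coefficient 1, and scaling identifies [S]
    with the nonzero constants times these representatives. *)
Lemma card_normalized (S : set {mpoly F[k]}) : finite_set S ->
  (forall f, S f -> f != 0) -> (forall c f, c != 0 -> S f -> S (c *: f)) ->
  (#|F|.-1 * #|` fset_set (@normalized F k @` S)| = #|` fset_set S|)%N.
Proof.
move=> finS S0 SZ; pose S1 := S `&` [set f | mleadc f = 1].
have finS1 : finite_set S1 by apply: sub_finite_set finS; apply: subIsetl.
have monicS f : S f -> exists2 c, c != 0 & S1 (c *: f).
  move=> Sf; have c0 : mleadc f != 0 by rewrite mleadc_eq0 S0.
  exists (mleadc f)^-1; first by rewrite invr_eq0.
  split; first by apply: SZ; rewrite ?invr_eq0.
  by rewrite /= mleadcZE mulVf.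
have imS : @normalized F k @` S = @normalized F k @` S1.
  apply/seteqP; split=> [_ [f Sf <-]|_ [f [Sf _] <-]]; last by exists f.
  have [c c0 S1f] := monicS f Sf; exists (c *: f) => //.
  apply/seteqP; split=> [_ [d /= d0 <-]|_ [d /= d0 <-]].
    by exists (d * c); rewrite /= ?mulf_neq0 // scalerA.
  exists (d / c); rewrite /= ?mulf_neq0 ?invr_eq0 //.
  by rewrite scalerA divfK.
rewrite imS card_fset_set_image //; last first.
  move=> f g [_ /= f1] [_ /= g1] fg.
  have : @normalized F k g f by rewrite -fg; exists 1; rewrite /= ?oner_eq0 ?scale1r.
  move=> [c /= c0 cg]; move: f1; rewrite -cg mleadcZE g1 mulr1 => ->.
  by rewrite scale1r.
have finU : finite_set [set c : F | c != 0] by exact: finite_finset.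
rewrite -card_nonzero -card_fset_setX //.
rewrite -(card_fset_set_image (f := fun cf => cf.1 *: cf.2)); first last.
- move=> [c f] [d g] [/= c0 [_ f1]] [/= d0 [_ g1]] e.
  have cd : c = d by move: (congr1 (fun h => mleadc h) e); rewrite !mleadcZE f1 g1 !mulr1.
  by rewrite cd in e *; rewrite (scalerI d0 e).
- exact: finite_setX.
congr #|` fset_set _|; apply/seteqP; split=> [_ [[c f] [/= c0 [Sf _]] <-]|f Sf].
  exact: SZ.
have [c c0 S1f] := monicS f Sf; exists (c^-1, c *: f).
  by split; rewrite //= invr_eq0.
by rewrite /= scalerA mulVf // scale1r.
Qed.

Lemma vdeg_setZ m c f : c != 0 -> @vdeg_set F k m f -> @vdeg_set F k m (c *: f).
Proof.
by move=> c0 [f0 fm]; split; rewrite ?vdegZ // scaler_eq0 negb_or c0.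
Qed.

Lemma irreducible_mpolyZ c f : c != 0 ->
  irreducible_mpoly f -> irreducible_mpoly (c *: f).
Proof.
move=> c0 [f0 fU fI]; split.
- by rewrite scaler_eq0 negb_or c0.
- by rewrite -mul_mpolyC unitrMr ?unit_mpolyC.
- move=> g h cf; have cV : c^-1 != 0 by rewrite invr_eq0.
  have fgh : f = (c^-1 *: g) * h.
    by rewrite -scalerAl -cf scalerA mulVf // scale1r.
  case: (fI _ _ fgh) => [|hU]; last by right.
  by rewrite -mul_mpolyC unitrMr ?unit_mpolyC //; left.
Qed.

Lemma card_num_normalized m :
  (#|F|.-1 * num_normalized F m = #|` fset_set (@vdeg_set F k m)|)%N.
Proof.
apply: card_normalized; first exact: finite_vdeg_set.
- by move=> f [].
- by move=> c f; apply: vdeg_setZ.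
Qed.

Lemma card_num_irreducible m :
  (#|F|.-1 * num_irreducible F m =
    #|` fset_set (@vdeg_set F k m `&` @irreducible_mpoly F k)|)%N.
Proof.
apply: card_normalized; first exact: finite_vdeg_setI.
- by move=> f [[]].
- move=> c f c0 [fm fI]; split; first exact: vdeg_setZ.
  exact: irreducible_mpolyZ.
Qed.

(** A polynomial of degree [a] is determined by its coefficients at the exponents [b <= a]. *)
Lemma leq_card_vdeg_set a :
  (#|` fset_set (@vdeg_set F k a)| <= #|F| ^ \prod_i (a i).+1)%N.
Proof.
pose D := {dffun forall i : 'I_k, 'I_(a i).+1}.
pose mon (b : D) : 'X_{1..k} := [multinom b i : nat | i < k].
rewrite -(card_fset_set_image (f := fun f => [ffun b : D => f@_(mon b)])).
- apply: leq_trans (leq_card_fset _) _.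
  rewrite card_ffun card_dep_ffun foldrE big_map big_enum /=.
  by rewrite (eq_bigr (fun i => (a i).+1)) // => i _; rewrite card_ord.
- exact: finite_vdeg_set.
move=> f g [_ fa] [_ ga] /ffunP fg; apply/mpolyP => b.
have [ba|nba] := pselect (forall i, (b i <= a i)%N).
  have := fg (finfun (fun i => inord (b i) : 'I_(a i).+1)).
  rewrite !ffunE; suff -> : mon (finfun (fun i => inord (b i))) = b by [].
  by apply/mnmP => i; rewrite mnmE ffunE inordK ?ltnS.
suff supp (h : {mpoly F[k]}) : vdeg h = a -> h@_b = 0 by rewrite !supp.
move=> ha; apply: memN_msupp_eq0; apply/negP => hb; apply: nba => i.
by rewrite -ha; have /vdeg_leP := leqnn (vdeg h i); apply.
Qed.

(* The non-primitive polynomials are the [x_i f + c p(f)] with [c] in [F] and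
   [p(f)] the primitive part of [f]: if [f = g p(f)] with [g] monic in
   [F[x_i]], the content of such a polynomial is [x_i g + c]. *)
Lemma card_nonprimitive i m : (0 < m i)%N ->
  #|` fset_set (@vdeg_set F k m `&` ~` @primitive_in F k i)| =
  (#|F| * #|` fset_set (@vdeg_set F k (m - U_(i))%MM)|)%N.
Proof.
move=> mi; pose V := @vdeg_set F k (m - U_(i))%MM.
have /choice[gp gpP] : forall f, exists gp : {poly F} * {mpoly F[k]}, f != 0 ->
    [/\ gp.1 \is monic, primitive_in i gp.2 & f = poly_in i gp.1 * gp.2].
  move=> f; have [->|f0] := eqVneq f 0; first by exists (0, 0) => /eqP[].
  by have [gp gpP] := content_exists i f0; exists gp.
pose ext (c : F) (g : {poly F}) := g * 'X + c%:P.
have size_ext c g : g \is monic -> size (ext c g) = (size g).+1.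
  by move=> gM; rewrite /ext size_MXaddC (negbTE (monic_neq0 gM)).
have lead_ext c g : g != 0 -> lead_coef (ext c g) = lead_coef g.
  move=> g0; rewrite lead_coefDl ?lead_coefMX // size_mulX //.
  by rewrite (leq_ltn_trans (size_polyC_leq1 c)) // ltnS size_poly_gt0.
have ext_monic c g : g \is monic -> ext c g \is monic.
  by move=> gM; rewrite monicE lead_ext ?monic_neq0 // (monicP gM).
have ext_inj c d g h : ext c g = ext d h -> c = d /\ g = h.
  move=> e; split.
    by have := congr1 (fun p : {poly F} => p`_0) e;
      rewrite /ext !coefD !coefMX !coefC !add0r.
  apply/polyP => j; have := congr1 (fun p : {poly F} => p`_j.+1) e.
  by rewrite /ext !coefD !coefMX !coefC !addr0.
pose Phi (cf : F * {mpoly F[k]}) :=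
  poly_in i (ext cf.1 (gp cf.2).1) * (gp cf.2).2.
have finV : finite_set V by exact: finite_vdeg_set.
have cardF : #|` fset_set [set: F]| = #|F|.
  rewrite -(card_finset (T := F) predT); congr #|` _|.
  apply/fsetP => c; rewrite in_fset_set; last exact: finite_finset.
  by apply/idP/idP; rewrite !inE.
have finF : finite_set [set: F] by exact: finite_finset.
rewrite -cardF -card_fset_setX //.
rewrite -(card_fset_set_image (f := Phi)); first last.
- move=> [c f] [d g] [_ /= [f0 _]] [_ /= [g0 _]]; rewrite /Phi /=.
  have [fM fP ef] := gpP f f0; have [gM gP eg] := gpP g g0.
  move=> /content_unique[] // ; try exact: ext_monic.
  by move=> /ext_inj[-> e1] e2; rewrite ef eg e1 e2.
- exact: finite_setX.
have vdeg_ext c g p : g \is monic -> p != 0 ->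
    vdeg (poly_in i (ext c g) * p) = (vdeg (poly_in i g * p) + U_(i))%MM.
  move=> gM p0; have g0 := monic_neq0 gM.
  rewrite !vdegM ?poly_in_neq0 // ?monic_neq0 ?ext_monic //.
  rewrite !vdeg_poly_in ?monic_neq0 ?ext_monic // size_ext //=.
  rewrite -addmA [(_ + U_(i))%MM]addmC addmA; congr (_ + _)%MM.
  have : (0 < size g)%N by rewrite size_poly_gt0.
  by case: (size g) => // s _; rewrite /= mulmS addmC.
congr #|` fset_set _|; apply/seteqP; split=> [f [[f0 fm] fnP]|_ [[c f] [_ /= [f0 fm]] <-]].
  have [[g p] [/= gM pP ef]] := content_exists i f0.
  have p0 := primitive_in_neq0 pP.
  have [c [g1 g1M eg]] : exists c, exists2 g1, g1 \is monic & g = ext c g1.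
    (* The quotient [g1] is again monic unless it vanishes; in that case [g = 1] and [f = p] would
       be primitive. *)
    elim/poly_ind: g gM ef => [/monic_neq0|g1 c _ gM ef]; first by rewrite eqxx.
    exists c; exists g1 => //; have [g10|g10] := eqVneq g1 0; last first.
      by rewrite monicE -(lead_ext c) // -monicE.
    case: fnP; move: gM ef; rewrite g10 mul0r add0r monicE lead_coefC.
    by move=> /eqP -> ->; rewrite poly_inC mpolyC1 mul1r.
  have f'0 : poly_in i g1 * p != 0 by rewrite mulf_neq0 ?poly_in_neq0 ?monic_neq0.
  exists (c, poly_in i g1 * p).
    split=> //; split=> //=.
    by rewrite -fm ef eg vdeg_ext // addmK.
  rewrite /Phi /= ef eg.
  have [gM' pP' e] := gpP _ f'0.
  by have [<- <-] := content_unique g1M gM' pP pP' e.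
have [gM pP ef] := gpP f f0; have p0 := primitive_in_neq0 pP.
split; last first.
  move=> /(_ _ _ erefl); rewrite /= size_ext // => -[] /eqP.
  by rewrite size_poly_eq0 (negbTE (monic_neq0 gM)).
split; first by rewrite mulf_neq0 // poly_in_neq0 // monic_neq0 // ext_monic.
rewrite /Phi /= vdeg_ext // -ef fm submK //.
by apply/mnm_lepP => j; rewrite mnm1E; case: eqP => // <-.
Qed.

End Counting.

(** * Primitive reducible polynomials and the sum over their degree splittings *)

Section ReduciblePrimitive.
Local Open Scope classical_set_scope.
Variables (F : finFieldType) (k : nat) (i : 'I_k).
Implicit Types (f : {mpoly F[k]}) (m : 'X_{1..k}).

(** In [f = h(x_i) r] one factor is a unit. It cannot be [r], because [f] involves [x_j]; thus [h]
    is constant. *)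
Lemma irreducible_primitive_in f j : j != i -> (0 < vdeg f j)%N ->
  irreducible_mpoly f -> primitive_in i f.
Proof.
move=> ji fj [f0 _ fI] h r fhr.
have [ih0 r0] : poly_in i h != 0 /\ r != 0.
  by apply/andP; rewrite -negb_or -mulf_eq0 -fhr.
have h0 : h != 0 by apply: contraNneq ih0 => ->; rewrite -[0]/(0%:P) poly_inC mpolyC0.
case: (fI _ _ fhr) => /unit_vdeg /mnmP hr.
  have := hr i; rewrite vdeg_poly_in // mulmnE mnm1E eqxx mul1n mnm0E => /eqP.
  by rewrite -subn1 subn_eq0 leq_eqVlt ltnS leqn0 size_poly_eq0 (negbTE h0) orbF => /eqP.
move: fj; rewrite fhr vdegM // mnmDE hr mnm0E addn0 vdeg_poly_in // mulmnE.
by rewrite mnm1E eq_sym (negbTE ji).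
Qed.

(** Otherwise [g] lies in [F[x_i]], and primitivity of [f] makes it a nonzero constant, a unit. *)
Lemma primitive_in_factor f g h : primitive_in i f -> f = g * h ->
  g \isn't a GRing.unit -> exists2 j, j != i & (0 < vdeg g j)%N.
Proof.
move=> fP fgh gU; apply: contrapT => ng.
have [p gp] : exists p, g = poly_in i p.
  apply: poly_in_surj => j ji; apply/eqP; rewrite eqn0Ngt; apply/negP => gj.
  by apply: ng; exists j.
have /eqP/size_poly1P[c c0 pc] : size p = 1%N by apply: (fP _ h); rewrite -gp.
by move: gU; rewrite gp pc poly_inC unit_mpolyC.
Qed.

Lemma reducible_primitive_in f : primitive_in i f -> f \isn't a GRing.unit ->
  ~ irreducible_mpoly f ->
  exists g h, [/\ f = g * h, exists2 j, j != i & (0 < vdeg g j)%N,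
    exists2 j, j != i & (0 < vdeg h j)%N & (mdeg (vdeg g) <= mdeg (vdeg h))%N].
Proof.
move=> fP fU fI.
have [g [h [fgh gU hU]]] : exists g h, [/\ f = g * h,
    g \isn't a GRing.unit & h \isn't a GRing.unit].
  apply: contrapT => nex; apply: fI; split=> // [|g h fgh].
    exact: primitive_in_neq0 fP.
  have [?|gU] := boolP (g \is a GRing.unit); first by left.
  have [?|hU] := boolP (h \is a GRing.unit); first by right.
  by case: nex; exists g, h.
have fhg : f = h * g by rewrite mulrC.
have [gh|hg] := leqP (mdeg (vdeg g)) (mdeg (vdeg h)).
  exists g, h; split=> //; first exact: primitive_in_factor fgh gU.
  exact: primitive_in_factor fhg hU.
exists h, g; split=> //; last exact: ltnW.
  exact: primitive_in_factor fhg hU.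
exact: primitive_in_factor fgh gU.
Qed.

(** A finite type covering all degrees [a <= m]. The common bound [mdeg m] keeps the function type
    non-dependent, so that [sum_expr_mdeg] can distribute a product over sums. *)
Definition degree_index m := {ffun 'I_k -> 'I_(mdeg m).+1}.
Definition mnm_of_index m (j : degree_index m) : 'X_{1..k} :=
  [multinom (j l : nat) | l < k].

Definition split_degree m (a : 'X_{1..k}) :=
  [&& (a <= m)%MM, [exists l, (l != i) && (0 < a l)%N],
      [exists l, (l != i) && (0 < (m - a)%MM l)%N]
    & (mdeg a <= mdeg (m - a)%MM)%N].

(** Union bound over the degree of the factor of smaller total degree: multiplication maps the pairs
    of degrees [a] and [m - a] onto a cover of the set. *)
Lemma leq_card_reducible_primitive m : m != 0%MM ->
  (#|` fset_set (@vdeg_set F k m `&` (@primitive_in F k i `\` @irreducible_mpoly F k))|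
   <= \sum_(j : degree_index m | split_degree m (mnm_of_index j))
        #|F| ^ (\prod_l (mnm_of_index j l).+1 + \prod_l ((m - mnm_of_index j)%MM l).+1))%N.
Proof.
move=> m0.
pose B (j : degree_index m) := (fun gh : {mpoly F[k]} * {mpoly F[k]} => gh.1 * gh.2) @`
  (@vdeg_set F k (mnm_of_index j) `*` @vdeg_set F k (m - mnm_of_index j)%MM).
have finV a : finite_set (@vdeg_set F k a) by exact: finite_vdeg_set.
have finVV a b : finite_set (@vdeg_set F k a `*` @vdeg_set F k b).
  exact: finite_setX.
apply: leq_trans (leq_card_fset_set_cover (P := fun j => split_degree m (mnm_of_index j))
  (B := B) _ _ _) _.
- exact: finite_vdeg_setI.
- by move=> j; apply: finite_image.
- move=> f [[f0 fm] [fP fI]].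
  have fU : f \isn't a GRing.unit.
    by apply: contra m0 => /unit_vdeg; rewrite fm => ->.
  have [g [h [fgh g1 h1 gh]]] := reducible_primitive_in fP fU fI.
  have [g0 h0] : g != 0 /\ h != 0 by apply/andP; rewrite -negb_or -mulf_eq0 -fgh.
  have mE : m = (vdeg g + vdeg h)%MM by rewrite -fm fgh vdegM.
  have gm : (vdeg g <= m)%MM by rewrite mE lem_addr.
  have hE : (m - vdeg g)%MM = vdeg h by rewrite mE addmC addmK.
  pose j : degree_index m := [ffun l => inord (vdeg g l)].
  have monj : mnm_of_index j = vdeg g.
    apply/mnmP => l; rewrite mnmE ffunE inordK // ltnS.
    apply: leq_trans (mnm_lepP gm l) _.
    by rewrite mdegE (bigD1 l) //= leq_addr.
  exists j; last first.
    by exists (g, h); rewrite ?fgh //; rewrite /= monj hE.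
  rewrite /split_degree monj hE gm gh andbT /=.
  by apply/andP; split; apply/existsP; [case: g1|case: h1] => l li lp; exists l;
    rewrite li.
apply: leq_sum => j _; apply: leq_trans (leq_card_fset_set_image _ (finVV _ _)) _.
by rewrite card_fset_setX // expnD leq_mul // leq_card_vdeg_set.
Qed.

Lemma card_primitive_in m : (0 < m i)%N ->
  (#|` fset_set (@vdeg_set F k m `&` @primitive_in F k i)|
   + #|F| * #|` fset_set (@vdeg_set F k (m - U_(i))%MM)|
   = #|` fset_set (@vdeg_set F k m)|)%N.
Proof.
move=> mi; rewrite -card_nonprimitive // -setDE.
exact/card_fset_setID/finite_vdeg_set.
Qed.

Lemma card_irreducible_primitive m j : j != i -> (0 < m j)%N ->
  (#|` fset_set (@vdeg_set F k m `&` @irreducible_mpoly F k)| +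
   #|` fset_set (@vdeg_set F k m `&` (@primitive_in F k i `\` @irreducible_mpoly F k))|
   = #|` fset_set (@vdeg_set F k m `&` @primitive_in F k i)|)%N.
Proof.
move=> ji mj; rewrite -[RHS](card_fset_setID (@irreducible_mpoly F k)); last first.
  exact: finite_vdeg_setI.
congr (_ + _)%N; congr #|` fset_set _|; last by rewrite setIDA.
apply/seteqP; split=> [f [[f0 fm] fI]|f [[fm _] fI]] //; do 2!split=> //.
by apply: (irreducible_primitive_in ji) fI; rewrite fm.
Qed.

Lemma leq_sum_geometric (R : realFieldType) (x : R) d : 0 <= x -> x <= 1 / 2 ->
  \sum_(e < d) x ^+ e <= 2.
Proof.
move=> x0 x2; elim: d => [|d IH]; first by rewrite big_ord0.
rewrite big_ord_recl /=; under eq_bigr do rewrite exprS.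
rewrite -mulr_sumr expr0; have : 0 <= \sum_(e < d) x ^+ e by apply: sumr_ge0 => e _; apply: exprn_ge0.
by nra.
Qed.

(** The sum factors into one truncated geometric series per variable, each at most 2; hence a bound
    independent of [m]. *)
Lemma sum_expr_mdeg (R : realFieldType) (x : R) m : 0 <= x -> x <= 1 / 2 ->
  \sum_(j : degree_index m) x ^+ mdeg (mnm_of_index j) <= 2 ^+ k.
Proof.
move=> x0 x2.
rewrite (eq_bigr (fun j : degree_index m => \prod_l x ^+ j l)); last first.
  by move=> j _; rewrite mdegE -expr_sum; congr (_ ^+ _); apply: eq_bigr => l _;
    rewrite mnmE.
rewrite -(bigA_distr_bigA (fun (_ : 'I_k) (e : 'I_(mdeg m).+1) => x ^+ e)) /=.
rewrite -[k in 2 ^+ k]card_ord -prodr_const; apply: ler_prod => l _.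
by rewrite leq_sum_geometric // sumr_ge0 // => e _; apply: exprn_ge0.
Qed.

End ReduciblePrimitive.

(** * Assembly of the error estimate *)

Unset Implicit Arguments.

Theorem theorem5p4 (R : realType) (F : finFieldType) (n : nat) :
  exists2 C : R, 0 < C &
    forall m : 'X_{1..n.+2},
      (forall i, (0 < m i)%N) ->
      m ord0 = (\max_(i < n.+2 | i != ord_max) m i)%N ->
      (n.+2 = 2%N -> (3 <= m ord0)%N) ->
      (n.+2 = 3%N -> (2 <= m ord0)%N) ->
      `| (num_irreducible F m)%:R
         - ((num_normalized F m)%:R
            - #|F|%:R * (num_normalized F (m - U_(ord_max))%MM)%:R) |
      <= C * #|F|%:R ^+ (m ord0 * \prod_(i < n.+2 | i != ord0) (m i).+1)%N.
Proof.
set q : R := #|F|%:R.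
have F1 : (1 < #|F|)%N := card_finNzRing_gt1 F.
have q2 : 2 <= q by rewrite ler_nat.
have q0 : 0 < q by lra.
(* [q ^+ 4] pays for the constant 4 in [exponent_bound], and [2 ^+ n.+2] for the sum over degree
   splittings. *)
exists (q ^+ 4 * 2 ^+ n.+2); first by rewrite mulr_gt0 ?exprn_gt0.
move=> m m0 mmax m3 m2; set T := (_ * _)%N.
pose i : 'I_n.+2 := ord_max.
have i0 : ord0 != i by [].
have := card_primitive_in F (m0 i).
rewrite -(card_irreducible_primitive F i0 (m0 ord0)).
rewrite -!card_num_normalized -card_num_irreducible.
set A := num_irreducible F m; set N := num_normalized F m.
set N' := num_normalized F _; set E := #|` _| => cardE.
(* The error is exact: up to the factor [q - 1] between classes and polynomials, it is minus the
   number [E] of primitive reducible polynomials of degree [m]. *)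
have {cardE} cardE : (q - 1) * (A%:R - (N%:R - q * N'%:R)) = - E%:R :> R.
  have := congr1 (fun x => x%:R : R) cardE.
  by rewrite !natrD !natrM -subn1 natrB ?(ltnW F1) // -/q; lra.
have leE : E%:R <= q ^+ 4 * 2 ^+ n.+2 * q ^+ T.
  have m_neq0 : m != 0%MM.
    by apply/eqP => /mnmP/(_ ord0)/eqP; rewrite mnm0E eqn0Ngt m0.
  have := leq_card_reducible_primitive F i m_neq0; rewrite -/E -(ler_nat R).
  move=> /le_trans; apply; rewrite natr_sum.
  have x0 : 0 <= q^-1 by rewrite invr_ge0 ltW.
  have x2 : q^-1 <= 1 / 2 by rewrite mul1r lef_pV2 ?posrE.
  apply: (@le_trans _ _ (q ^+ (T + 4) *
    \sum_(j : degree_index m) q^-1 ^+ mdeg (mnm_of_index j))).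
    rewrite mulr_sumr big_mkcond /=; apply: ler_sum => j _.
    case: ifP => [|_]; last by rewrite mulr_ge0 ?exprn_ge0 // ltW.
    move=> /and4P[jm /existsP[l /andP[li lj]] /existsP[l' /andP[li' lj']] jj].
    set a := mnm_of_index j in jm lj lj' jj *.
    have abm : (a + (m - a))%MM = m by rewrite addmC submK.
    have := exponent_bound m0 mmax m3 m2 abm (ex_intro2 _ _ l li lj)
      (ex_intro2 _ _ l' li' lj').
    (* [split_degree] orders the factors by total degree, so the minimum is [mdeg a], the exponent
       of [q^-1] in the sum. *)
    rewrite (minn_idPl jj) -/T => bound.
    rewrite natrX exprVn ler_pdivlMr ?exprn_gt0 // -exprD.
    by rewrite ler_weXn2l //; lra.
  rewrite mulrAC -exprD [(4 + T)%N]addnC.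
  by rewrite ler_wpM2l ?sum_expr_mdeg // exprn_ge0 // ltW.
apply: le_trans leE.
(* Since [q - 1 >= 1], the error is at most [E] in absolute value. *)
have -> : E%:R = (q - 1) * `|A%:R - (N%:R - q * N'%:R)|.
  have q1 : 0 <= q - 1 by lra.
  by rewrite -{1}(ger0_norm q1) -normrM cardE normrN normr_nat.
by rewrite ler_peMl //; lra.
Qed.
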